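(* Let $\Lambda=(\mathcal{E},\mathcal{N})$ be a finite directed graph with edges $e_1,\dots,e_{n_e}$ as described in the context, with edge lengths $|e_k|>0$, advection speeds $c_k\ge 0$ and time step $\Delta t>0$, and let $M_{\mathrm{tr}}\in\mathbb{R}^{n_e\times n_e}$ be the matrix with entries $$(M_{\mathrm{tr}})_{ki}=\begin{cases}\dfrac{|e_k|}{\Delta t}+c_k, & i=k,\\[2mm] -c_k w_i, & i\neq k,\ e_i\in\mathcal{E}_k^+,\\ 0,&\text{otherwise.}\end{cases}$$ Then $M_{\mathrm{tr}}$ is invertible, and the system $M_{\mathrm{tr}}\mathbf{u}=\mathbf{g}$ is positive, i.e. for every $\mathbf{g}\in\mathbb{R}^{n_e}$ with all entries non-negative, the solution $\mathbf{u}$ has all entries non-negative.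
   Context: $\Lambda=(\mathcal{E},\mathcal{N})$ is a finite, connected, simple, directed graph with edges $\mathcal{E}=\{e_k\}_{k=1}^{n_e}$. Each edge $e_k$ has length $|e_k|>0$ and two distinct endpoints: its inflow endpoint, denoted $\pi_k(1)$, and its outflow endpoint, denoted $\pi_k(0)$ (the advective flux on $e_k$ is directed from $\pi_k(1)$ to $\pi_k(0)$). An edge $e_k$ is incoming to a node $v$ if $\pi_k(0)=v$ and outgoing from $v$ if $\pi_k(1)=v$; $\mathcal{E}_v^+$ and $\mathcal{E}_v^-$ denote the sets of edges incoming to and outgoing from $v$. Every node belonging to at least two edges has at least one incoming and at least one outgoing edge. For an edge $e_k$, $\mathcal{E}_k^+=\{e_j\in\mathcal{E}:\pi_j(0)=\pi_k(1)\}$ is the set of edges incoming to the inflow endpoint of $e_k$. On each edge the advection speed is a constant $c_k\ge 0$. For an edge $e_i$ whose outflow endpoint $v=\pi_i(0)$ has at least one outgoing edge, the weight is $$w_i=\frac{c_i}{\sum_{e_l\in\mathcal{E}_v^-}c_l},$$ and it is assumed that all the denominators appearing here are positive. *)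

(* Defs.v *)
From HB Require Import structures.
From mathcomp Require Import all_boot all_order all_algebra.
From mathcomp Require Import reals.

Set Implicit Arguments.
Unset Strict Implicit.
Unset Printing Implicit Defensive.

Import Order.TTheory GRing.Theory Num.Theory.
Local Open Scope ring_scope.

(* A finite directed graph with node set V and edges indexed by 'I_n is given
   by two maps 'I_n -> V, with [inflow k] = pi_k(1) and [outflow k] = pi_k(0):
   the flux on edge k runs from [inflow k] to [outflow k]. *)
Section Digraph.
Variables (V : finType) (n : nat) (inflow outflow : 'I_n -> V).

Definition in_edges (v : V) : {set 'I_n} := [set k | outflow k == v].
Definition out_edges (v : V) : {set 'I_n} := [set k | inflow k == v].

(* E_k^+ *)
Definition upstream_edges (k : 'I_n) : {set 'I_n} := in_edges (inflow k).

(* No loops and no two edges with the same ordered pair of endpoints; a pair of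
   edges of opposite directions between two nodes is allowed. *)
Definition simple_digraph : Prop :=
  (forall k, inflow k != outflow k) /\
  injective (fun k => (inflow k, outflow k)).

Definition adjacent : rel V := fun u v =>
  [exists k, ((inflow k == u) && (outflow k == v))
          || ((inflow k == v) && (outflow k == u))].

(* Connectedness disregards the direction of the edges. *)
Definition connected_digraph : Prop := forall u v, connect adjacent u v.

Definition flow_through : Prop := forall v,
  (1 < #|in_edges v :|: out_edges v|)%N ->
  in_edges v != set0 /\ out_edges v != set0.

Variables (R : realType) (len c : 'I_n -> R) (dt : R).

Definition outflow_speed (v : V) : R := \sum_(l in out_edges v) c l.

Definition positive_denominators : Prop := forall i,
  out_edges (outflow i) != set0 -> 0 < outflow_speed (outflow i).

(* Meaningful only when [outflow i] has an outgoing edge; the value is the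
   junk c i / 0 = 0 otherwise, and [transport_mx] never uses it then. *)
Definition weight (i : 'I_n) : R := c i / outflow_speed (outflow i).

Definition transport_mx : 'M[R]_n :=
  \matrix_(k, i)
    if i == k then len k / dt + c k
    else if i \in upstream_edges k then - (c k * weight i)
    else 0.

End Digraph.

(* Main.v *)
Require Import Defs.
From HB Require Import structures.
From mathcomp Require Import all_boot all_order all_algebra.
From mathcomp Require Import reals.

Set Implicit Arguments.
Unset Strict Implicit.
Unset Printing Implicit Defensive.

Import Order.TTheory GRing.Theory Num.Theory.
Local Open Scope ring_scope.

(* Every column of [M] sums to at least [len i / dt > 0], because the weights
   distribute [c i] over the edges leaving [outflow i], and the off-diagonal
   entries are nonpositive.  If [M u >= 0] had a solution with nonempty negative
   support [N], adding the equations indexed by [N] would give a negative number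
   on the left.  Positivity applied to [u] and [- u] yields injectivity. *)

Section ColumnDominantZMatrix.
Variables (R : realFieldType) (n : nat) (M : 'M[R]_n).
Hypothesis offdiag_le0 : forall k i, i != k -> M k i <= 0.
Hypothesis colsum_gt0 : forall i, 0 < \sum_k M k i.

Lemma zmatrix_monotone (u : 'cV[R]_n) :
  (forall k, 0 <= (M *m u) k 0) -> forall k, 0 <= u k 0.
Proof.
move=> Mu_ge0 k0; rewrite leNgt; apply/negP => uk0_lt0.
(* For a column [i] in the negative support, the rows discarded lie outside it, so they carry only
   off-diagonal entries, and dropping nonpositive terms cannot lower the sum. *)
have partial_gt0 i : u i 0 < 0 -> 0 < \sum_(k | u k 0 < 0) M k i.
  move=> ui_lt0; apply: (lt_le_trans (colsum_gt0 i)).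
  rewrite (bigID (fun k => u k 0 < 0)) /= gerDl; apply: sumr_le0 => k uk_ge0.
  by apply: offdiag_le0; apply: contraNneq uk_ge0 => <-.
(* For [i] outside the support, every entry kept is off-diagonal, so the factors have opposite signs
   here too. *)
have term_le0 i : (\sum_(k | u k 0 < 0) M k i) * u i 0 <= 0.
  have [ui_lt0|ui_ge0] := ltP (u i 0) 0.
    by rewrite nmulr_lle0 // ltW // partial_gt0.
  apply: mulr_le0_ge0 => //; apply: sumr_le0 => k uk_lt0.
  by apply: offdiag_le0; apply: contraTneq uk_lt0 => <-; rewrite -leNgt.
have : 0 <= \sum_(k | u k 0 < 0) (M *m u) k 0 by apply: sumr_ge0.
under eq_bigr do rewrite mxE.
(* Regrouped by columns, the sum has only nonpositive terms, and the one at [k0] is strictly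
   negative. *)
rewrite exchange_big /=; under eq_bigr do rewrite -mulr_suml.
apply/negP; rewrite -ltNge (bigD1 k0) //=.
apply: ltr_wnDr; first by apply: sumr_le0.
by rewrite pmulr_rlt0 // partial_gt0.
Qed.

Lemma zmatrix_unitmx : M \in unitmx.
Proof.
(* [kermx] is a left kernel; transposing turns it into the solutions of [M *m u = 0]. *)
rewrite -unitmx_tr -row_free_unit -kermx_eq0; apply/rowV0P => v /sub_kermxP vM0.
have MvT0 : M *m v^T = 0 by apply: trmx_inj; rewrite trmx_mul trmxK trmx0.
apply/rowP => k; apply/eqP; rewrite mxE eq_le; apply/andP; split.
  have := @zmatrix_monotone (- v^T).
  rewrite mulmxN MvT0 oppr0 => /(_ _ k); rewrite !mxE oppr_ge0; apply.
  by move=> j; rewrite mxE.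
have := @zmatrix_monotone v^T; rewrite MvT0 => /(_ _ k); rewrite mxE; apply.
by move=> j; rewrite mxE.
Qed.

End ColumnDominantZMatrix.

Section TransportMatrix.
Variables (R : realType) (V : finType) (n : nat) (inflow outflow : 'I_n -> V).
Variables (len c : 'I_n -> R) (dt : R).
Hypothesis c_ge0 : forall k, 0 <= c k.

Let M := transport_mx inflow outflow len c dt.

Lemma outflow_speed_ge0 v : 0 <= outflow_speed inflow c v.
Proof. by apply: sumr_ge0 => l _; apply: c_ge0. Qed.

Lemma weight_ge0 i : 0 <= weight inflow outflow c i.
Proof. by rewrite divr_ge0 ?outflow_speed_ge0. Qed.

Lemma transport_mx_offdiag_le0 k i : i != k -> M k i <= 0.
Proof.
move=> /negbTE ik; rewrite mxE ik; case: ifP => // _.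
by rewrite oppr_le0 mulr_ge0 ?weight_ge0.
Qed.

(** Equality holds unless the total speed vanishes, as when no edge leaves [outflow i]; the left
    side is then 0. *)
Lemma weight_outflow_speed_le i :
  outflow_speed inflow c (outflow i) * weight inflow outflow c i <= c i.
Proof.
rewrite /weight; have [->|S_neq0] := eqVneq (outflow_speed inflow c (outflow i)) 0.
  by rewrite mul0r.
by rewrite mulrC divfK.
Qed.

Lemma transport_mx_colsum_ge i : len i / dt <= \sum_k M k i.
Proof.
rewrite (bigD1 i) //= mxE eqxx -addrA lerDl.
rewrite -lerBlDl sub0r lerNl.
apply: le_trans (weight_outflow_speed_le i).
(* Both sums are extended by zeros to all edges and compared termwise: the terms agree for [k != i],
   and at [k = i] the left one is 0. *)
rewrite -sumrN mulr_suml [leRHS]big_mkcond [leLHS]big_mkcond /=.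
apply: ler_sum => k _; rewrite inE mxE !inE (eq_sym i k) (eq_sym (outflow i)).
have cw_ge0 : 0 <= c k * weight inflow outflow c i by rewrite mulr_ge0 ?weight_ge0.
by case: (k == i) => /=; case: (inflow k == outflow i); rewrite ?opprK ?oppr0.
Qed.

End TransportMatrix.

Theorem theorem1 (R : realType) (V : finType) (n : nat)
    (inflow outflow : 'I_n -> V) (len c : 'I_n -> R) (dt : R)
    (graph_simple : simple_digraph inflow outflow)
    (graph_connected : connected_digraph inflow outflow)
    (graph_flow : flow_through inflow outflow)
    (len_gt0 : forall k, 0 < len k)
    (c_ge0 : forall k, 0 <= c k)
    (dt_gt0 : 0 < dt)
    (den_gt0 : positive_denominators inflow outflow c) :
  let M := transport_mx inflow outflow len c dt in
  M \in unitmx /\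
  (forall g u : 'cV[R]_n,
     (forall k, 0 <= g k 0) -> M *m u = g -> forall k, 0 <= u k 0).
Proof.
move=> M.
have offdiag_le0 : forall k i, i != k -> M k i <= 0.
  exact: transport_mx_offdiag_le0.
have colsum_gt0 i : 0 < \sum_k M k i.
  by apply: lt_le_trans (transport_mx_colsum_ge _ _ _ _ c_ge0 i); rewrite divr_gt0.
split; first exact: zmatrix_unitmx.
by move=> g u g_ge0 Mu; apply: (zmatrix_monotone offdiag_le0 colsum_gt0); rewrite Mu.
Qed.
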